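(* Let $d_1,d_2,d_3$ be positive integers and let $\mathcal{S}\subseteq \mathbb{C}^{d_1}\otimes\mathbb{C}^{d_2}\otimes\mathbb{C}^{d_3}$ be an orthogonal set that is a special set of GHZ like states under the computational basis, and suppose that $\mathcal{S}$ is plane containing. Then $\mathcal{S}$ is of the strongest nonlocality if and only if all three corresponding graphs $\mathcal{G}_A(\mathcal{S})$, $\mathcal{G}_B(\mathcal{S})$, $\mathcal{G}_C(\mathcal{S})$ are connected.
   Context: The three tensor factors $\mathbb{C}^{d_1},\mathbb{C}^{d_2},\mathbb{C}^{d_3}$ belong to parties $A,B,C$. Write $\mathbb{Z}_d=\{0,1,\dots,d-1\}$; the computational basis of $\mathbb{C}^d$ is $\{|i\rangle : i\in\mathbb{Z}_d\}$, and $|i\rangle_A|j\rangle_B|k\rangle_C=|i\rangle\otimes|j\rangle\otimes|k\rangle$. States are nonzero vectors and normalization factors are ignored. A set of states is orthogonal if its distinct elements are mutually orthogonal. GHZ like states: a pair of GHZ like states (under the computational basis) is a pair of vectors $|i_1\rangle_A|j_1\rangle_B|k_1\rangle_C\pm|i_2\rangle_A|j_2\rangle_B|k_2\rangle_C$ with $i_1\neq i_2$, $j_1\neq j_2$, $k_1\neq k_2$. A set $\mathcal{S}$ is a special set of GHZ like states under the computational basis if it can be partitioned into such pairs (both the $+$ and the $-$ vector of each pair belonging to $\mathcal{S}$). Plane containing: let $\mathcal{C}(\mathcal{S})\subseteq\mathbb{Z}_{d_1}\times\mathbb{Z}_{d_2}\times\mathbb{Z}_{d_3}$ be the set of all triples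 $(i_1,j_1,k_1)$ and $(i_2,j_2,k_2)$ such that the pair $|i_1\rangle_A|j_1\rangle_B|k_1\rangle_C\pm|i_2\rangle_A|j_2\rangle_B|k_2\rangle_C$ is in $\mathcal{S}$. $\mathcal{S}$ is plane containing if there are $i_0\in\mathbb{Z}_{d_1}$, $j_0\in\mathbb{Z}_{d_2}$, $k_0\in\mathbb{Z}_{d_3}$ such that $\mathcal{C}(\mathcal{S})$ contains $\{i_0\}\times\mathbb{Z}_{d_2}\times\mathbb{Z}_{d_3}$, $\mathbb{Z}_{d_1}\times\{j_0\}\times\mathbb{Z}_{d_3}$ and $\mathbb{Z}_{d_1}\times\mathbb{Z}_{d_2}\times\{k_0\}$. Corresponding graphs: $\mathcal{G}_A(\mathcal{S})$ has vertex set $\mathbb{Z}_{d_2}\times\mathbb{Z}_{d_3}$, and $\{(j_1,k_1),(j_2,k_2)\}$ is an edge iff there exist $i_1,i_2\in\mathbb{Z}_{d_1}$ such that the pair $|i_1\rangle_A|j_1\rangle_B|k_1\rangle_C\pm|i_2\rangle_A|j_2\rangle_B|k_2\rangle_C$ is in $\mathcal{S}$. $\mathcal{G}_B(\mathcal{S})$ has vertex set $\mathbb{Z}_{d_3}\times\mathbb{Z}_{d_1}$, and $\{(k_1,i_1),(k_2,i_2)\}$ is an edge iff there exist $j_1,j_2\in\mathbb{Z}_{d_2}$ with that pair in $\mathcal{S}$. $\mathcal{G}_C(\mathcal{S})$ has vertex set $\mathbb{Z}_{d_1}\times\mathbb{Z}_{d_2}$, and $\{(i_1,j_1),(i_2,j_2)\}$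 is an edge iff there exist $k_1,k_2\in\mathbb{Z}_{d_3}$ with that pair in $\mathcal{S}$. Strongest nonlocality: a POVM on a Hilbert space is a finite family of positive semidefinite operators summing to the identity; it is trivial if every element is a scalar multiple of the identity. For a bipartition $X|Y$ of $\{A,B,C\}$, a POVM performed on one side, say $Y$, is orthogonality preserving for $\mathcal{S}$ if each of its elements $E$ satisfies $\langle\phi|\,\mathbb{I}_X\otimes E\,|\psi\rangle=0$ for all distinct $|\phi\rangle,|\psi\rangle\in\mathcal{S}$. An orthogonal set $\mathcal{S}$ is of the strongest nonlocality if for each bipartition ($A|BC$, $B|CA$, $C|AB$), every orthogonality-preserving POVM performed by either side of the bipartition is trivial (the two-party sides measuring jointly). *)

(* Defs.v *)
From HB Require Import structures.
From mathcomp Require Import all_boot all_order all_algebra.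
From mathcomp Require Import sesquilinear spectral.
From mathcomp Require Import boolp classical_sets reals.
From mathcomp Require Import complex mxtens.

Set Implicit Arguments.
Unset Strict Implicit.
Unset Printing Implicit Defensive.

Import Order.TTheory GRing.Theory Num.Theory.
Local Open Scope classical_set_scope.
Local Open Scope sesquilinear_scope.
Local Open Scope ring_scope.
Local Open Scope complex_scope.

Section Operators.
Variable C : numClosedFieldType.

Definition braket n (u v : 'cV[C]_n) : C := (u^t* *m v) 0 0.

(* [0 <= z] in a [numClosedFieldType] also says that [z] is real, so no separate
   hermiticity requirement is needed. *)
Definition psdmx n (E : 'M[C]_n) : Prop :=
  forall v : 'cV[C]_n, 0 <= braket v (E *m v).

Definition povm n r (E : 'I_r -> 'M[C]_n) : Prop :=
  (forall k, psdmx (E k)) /\ \sum_(k < r) E k = 1%:M.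

Definition trivial_povm n r (E : 'I_r -> 'M[C]_n) : Prop :=
  forall k, is_scalar_mx (E k).

Definition orthogonal_set n (S : set 'cV[C]_n) : Prop :=
  forall phi psi, S phi -> S psi -> phi <> psi -> braket phi psi = 0.

Definition preserves_orthogonality n (S : set 'cV[C]_n) (E : 'M[C]_n) : Prop :=
  forall phi psi, S phi -> S psi -> phi <> psi -> braket phi (E *m psi) = 0.

(* [ext] sends an operator on the measured side to the operator on the whole
   space that acts as the identity on the other side. *)
Definition only_trivial_povm n m (S : set 'cV[C]_n) (ext : 'M[C]_m -> 'M[C]_n) :
    Prop :=
  forall r (E : 'I_r -> 'M[C]_m),
    povm E -> (forall k, preserves_orthogonality S (ext (E k))) ->
    trivial_povm E.

Definition ket d (i : 'I_d) : 'cV[C]_d := delta_mx i 0.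

Definition ket3 d1 d2 d3 (t : 'I_d1 * 'I_d2 * 'I_d3) : 'cV[C]_(d1 * d2 * d3) :=
  ket t.1.1 *t ket t.1.2 *t ket t.2.

Section Tripartite.
Variables d1 d2 d3 : nat.

(* The unitary reordering the factors A, B, C as B, C, A:
   the sum of the |j>|k>|i> <i|<j|<k|. *)
Definition to_BCA : 'M[C]_(d2 * d3 * d1, d1 * d2 * d3) :=
  \sum_(i < d1) \sum_(j < d2) \sum_(k < d3)
    ket3 (j, k, i) *m (ket3 (i, j, k))^t*.

Definition to_CAB : 'M[C]_(d3 * d1 * d2, d1 * d2 * d3) :=
  \sum_(i < d1) \sum_(j < d2) \sum_(k < d3)
    ket3 (k, i, j) *m (ket3 (i, j, k))^t*.

Definition ext_A (E : 'M[C]_d1) : 'M[C]_(d1 * d2 * d3) :=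
  E *t (1%:M : 'M_d2) *t (1%:M : 'M_d3).

Definition ext_B (E : 'M[C]_d2) : 'M[C]_(d1 * d2 * d3) :=
  (1%:M : 'M_d1) *t E *t (1%:M : 'M_d3).

Definition ext_C (E : 'M[C]_d3) : 'M[C]_(d1 * d2 * d3) :=
  (1%:M : 'M_d1) *t (1%:M : 'M_d2) *t E.

Definition ext_AB (E : 'M[C]_(d1 * d2)) : 'M[C]_(d1 * d2 * d3) :=
  E *t (1%:M : 'M_d3).

Definition ext_BC (E : 'M[C]_(d2 * d3)) : 'M[C]_(d1 * d2 * d3) :=
  to_BCA^t* *m (E *t (1%:M : 'M_d1)) *m to_BCA.

Definition ext_CA (E : 'M[C]_(d3 * d1)) : 'M[C]_(d1 * d2 * d3) :=
  to_CAB^t* *m (E *t (1%:M : 'M_d2)) *m to_CAB.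

Implicit Type S : set 'cV[C]_(d1 * d2 * d3).

Definition strongest_nonlocal S : Prop :=
  [/\ only_trivial_povm S ext_A /\ only_trivial_povm S ext_BC,
      only_trivial_povm S ext_B /\ only_trivial_povm S ext_CA
    & only_trivial_povm S ext_C /\ only_trivial_povm S ext_AB].

Local Notation idx := ('I_d1 * 'I_d2 * 'I_d3)%type.

Definition ghz_like (a b : idx) : Prop :=
  [/\ a.1.1 <> b.1.1, a.1.2 <> b.1.2 & a.2 <> b.2].

Definition ghz_pair (p : idx * idx) : set 'cV[C]_(d1 * d2 * d3) :=
  [set ket3 p.1 + ket3 p.2; ket3 p.1 - ket3 p.2].

Definition special_ghz_set S : Prop :=
  exists P : set (idx * idx),
    (forall p, P p -> ghz_like p.1 p.2) /\ partition P ghz_pair S.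

(* "The pair |a> +- |b> is in S", for the unordered pair {a, b}: since states are
   taken up to normalization, the minus vector may occur as |a> - |b> or as
   |b> - |a>. *)
Definition pair_in S (a b : idx) : Prop :=
  ghz_like a b /\ (ghz_pair (a, b) `<=` S \/ ghz_pair (b, a) `<=` S).

Definition cells S : set idx := [set a | exists b, pair_in S a b].

Definition plane_containing S : Prop :=
  exists (i0 : 'I_d1) (j0 : 'I_d2) (k0 : 'I_d3),
    [/\ forall j k, cells S (i0, j, k),
        forall i k, cells S (i, j0, k)
      & forall i j, cells S (i, j, k0)].

Definition graph_A S : rel ('I_d2 * 'I_d3) := fun x y =>
  `[< exists i1 i2 : 'I_d1, pair_in S (i1, x.1, x.2) (i2, y.1, y.2) >].

Definition graph_B S : rel ('I_d3 * 'I_d1) := fun x y =>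
  `[< exists j1 j2 : 'I_d2, pair_in S (x.2, j1, x.1) (y.2, j2, y.1) >].

Definition graph_C S : rel ('I_d1 * 'I_d2) := fun x y =>
  `[< exists k1 k2 : 'I_d3, pair_in S (x.1, x.2, k1) (y.1, y.2, k2) >].

End Tripartite.
End Operators.

Definition graph_connected (V : finType) (e : rel V) : Prop :=
  forall x y, connect e x y.

(* Main.v *)
(** Sandwiching an orthogonality-preserving operator M between the two states of
    a GHZ pair {a, b} gives M_aa = M_bb; between the states of two different
    pairs it gives M_ac = 0.  For the operator extending E from one side of a
    bipartition, M_ab is the entry of E at the measured coordinates of a and b
    when the unmeasured coordinates agree, and 0 otherwise.  A full plane of
    cells therefore kills every off-diagonal entry of E, and the diagonal of E is
    constant along the edges of the graph of the measured side.  Conversely, the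
    projection onto a connected component, with its complement, is an
    orthogonality-preserving POVM. *)

Require Import Defs.
From mathcomp Require Import all_boot all_order all_algebra.
From mathcomp Require Import sesquilinear spectral.
From mathcomp Require Import boolp classical_sets reals.
From mathcomp Require Import complex mxtens.
From mathcomp Require Import ring.

Set Implicit Arguments.
Unset Strict Implicit.
Unset Printing Implicit Defensive.

Import Order.TTheory GRing.Theory Num.Theory.
Local Open Scope classical_set_scope.
Local Open Scope sesquilinear_scope.
Local Open Scope ring_scope.

Lemma homo_connect (T T' : finType) (e : rel T) (e' : rel T') (h : T -> T') :
  {homo h : x y / e x y >-> e' x y} ->
  {homo h : x y / connect e x y >-> connect e' x y}.
Proof.
move=> eh x y /connectP[p ep ->]; apply/connectP; exists (map h p).
  exact: homo_path ep.
by rewrite last_map.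
Qed.

(** * Sesquilinearity of the bracket *)

Section Braket.
Variable C : numClosedFieldType.

Lemma braketDl n (u v w : 'cV[C]_n) : braket (u + v) w = braket u w + braket v w.
Proof. by rewrite /braket linearD map_mxD mulmxDl mxE. Qed.

Lemma braketNl n (u w : 'cV[C]_n) : braket (- u) w = - braket u w.
Proof. by rewrite /braket linearN map_mxN mulNmx mxE. Qed.

Lemma braketDr n (u v w : 'cV[C]_n) : braket w (u + v) = braket w u + braket w v.
Proof. by rewrite /braket mulmxDr mxE. Qed.

Lemma braketNr n (u w : 'cV[C]_n) : braket w (- u) = - braket w u.
Proof. by rewrite /braket mulmxN mxE. Qed.

Lemma braket_mull n m (T : 'M[C]_(n, m)) (u : 'cV_m) v :
  braket (T *m u) v = braket u (T^t* *m v).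
Proof. by rewrite /braket trmx_mul map_mxM mulmxA. Qed.

Lemma psdmx_diag n (d : 'rV[C]_n) : (forall i, 0 <= d 0 i) -> psdmx (diag_mx d).
Proof.
move=> d_ge0 v; rewrite /braket mul_diag_mx mxE sumr_ge0 // => i _.
by rewrite !mxE mulrCA mulr_ge0 // mulrC mul_conjC_ge0.
Qed.

End Braket.

(** * Basis cells and the entries of extended operators *)

Section Tripartite.
Variable C : numClosedFieldType.

Definition cell d1 d2 d3 (t : 'I_d1 * 'I_d2 * 'I_d3) : 'I_(d1 * d2 * d3) :=
  mxtens_index (mxtens_index t.1, t.2).

Lemma mxtens_index_inj m n : injective (@mxtens_index m n).
Proof. exact: can_inj (@mxtens_indexK m n). Qed.

Lemma cell_inj d1 d2 d3 : injective (@cell d1 d2 d3).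
Proof.
move=> [p k] [p' k'] /mxtens_index_inj/pair_equal_spec[].
by move=> /mxtens_index_inj /= -> ->.
Qed.

Lemma ket3E d1 d2 d3 (t : 'I_d1 * 'I_d2 * 'I_d3) :
  ket3 C t = delta_mx (cell t) 0.
Proof.
apply/matrixP => r c; case: t => [[i j] k].
case: (mxtens_indexP r) => r12 r3; case: (mxtens_indexP r12) => r1 r2.
rewrite !mxE !mxtens_indexK /= [c]ord1 (inj_eq (@mxtens_index_inj _ _)).
rewrite xpair_eqE (inj_eq (@mxtens_index_inj _ _)) xpair_eqE.
by rewrite !ord1 !eqxx !andbT -!natrM !mulnb.
Qed.

Lemma braket_ket3 d1 d2 d3 (M : 'M[C]_(d1 * d2 * d3)) a b :
  braket (ket3 C a) (M *m ket3 C b) = M (cell a) (cell b).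
Proof.
by rewrite /braket !ket3E trmx_delta map_delta_mx mulmxA -rowE -colE !mxE.
Qed.

(** Common form of [to_BCA] and [to_CAB]: by orthonormality of the product basis only the term at
    [t] survives. *)
Lemma sum_ket3_bra d1 d2 d3 m (F : 'I_d1 * 'I_d2 * 'I_d3 -> 'cV[C]_m) t :
  (\sum_(i < d1) \sum_(j < d2) \sum_(k < d3)
     F (i, j, k) *m (ket3 C (i, j, k))^t*) *m ket3 C t = F t.
Proof.
rewrite pair_bigA pair_bigA /= mulmx_suml (bigD1 t) //= big1 ?addr0 => [|s ns].
  rewrite -!surjective_pairing -mulmxA ket3E trmx_delta map_delta_mx.
  by rewrite mul_delta_mx [delta_mx _ _]mx11_scalar mxE eqxx mulmx1.
rewrite -!surjective_pairing -mulmxA !ket3E trmx_delta map_delta_mx.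
by rewrite mul_delta_mx_0 ?mulmx0 // (inj_eq (@cell_inj _ _ _)).
Qed.

Variables d1 d2 d3 : nat.
Local Notation idx := ('I_d1 * 'I_d2 * 'I_d3)%type.
Local Notation ket3 := (ket3 C).

Lemma to_BCA_ket3 i j k : to_BCA C d1 d2 d3 *m ket3 (i, j, k) = ket3 (j, k, i).
Proof. exact: (sum_ket3_bra (fun t => ket3 (t.1.2, t.2, t.1.1))). Qed.

Lemma to_CAB_ket3 i j k : to_CAB C d1 d2 d3 *m ket3 (i, j, k) = ket3 (k, i, j).
Proof. exact: (sum_ket3_bra (fun t => ket3 (t.2, t.1.1, t.1.2))). Qed.

Lemma ext_AE E a b : @ext_A C d1 d2 d3 E (cell a) (cell b) =
  ((a.1.2, a.2) == (b.1.2, b.2))%:R * E a.1.1 b.1.1.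
Proof.
case: a b => [[i j] k] [[i' j'] k']; rewrite !tensmxE !mxE xpair_eqE /=.
by rewrite -mulrA -natrM mulnb mulrC.
Qed.

Lemma ext_BE E a b : @ext_B C d1 d2 d3 E (cell a) (cell b) =
  ((a.1.1, a.2) == (b.1.1, b.2))%:R * E a.1.2 b.1.2.
Proof.
case: a b => [[i j] k] [[i' j'] k']; rewrite !tensmxE !mxE xpair_eqE /=.
by rewrite mulrAC -natrM mulnb.
Qed.

Lemma ext_CE E a b : @ext_C C d1 d2 d3 E (cell a) (cell b) =
  (a.1 == b.1)%:R * E a.2 b.2.
Proof.
case: a b => [[i j] k] [[i' j'] k']; rewrite !tensmxE !mxE xpair_eqE /=.
by rewrite -natrM mulnb.
Qed.

Lemma ext_ABE E a b : @ext_AB C d1 d2 d3 E (cell a) (cell b) =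
  (a.2 == b.2)%:R * E (mxtens_index a.1) (mxtens_index b.1).
Proof. by rewrite tensmxE mxE mulrC. Qed.

Lemma ext_BCE E a b : @ext_BC C d1 d2 d3 E (cell a) (cell b) =
  (a.1.1 == b.1.1)%:R *
    E (mxtens_index (a.1.2, a.2)) (mxtens_index (b.1.2, b.2)).
Proof.
case: a b => [[i j] k] [[i' j'] k']; rewrite -braket_ket3 -!mulmxA.
by rewrite -braket_mull !to_BCA_ket3 braket_ket3 tensmxE mxE mulrC.
Qed.

Lemma ext_CAE E a b : @ext_CA C d1 d2 d3 E (cell a) (cell b) =
  (a.1.2 == b.1.2)%:R *
    E (mxtens_index (a.2, a.1.1)) (mxtens_index (b.2, b.1.1)).
Proof.
case: a b => [[i j] k] [[i' j'] k']; rewrite -braket_ket3 -!mulmxA.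
by rewrite -braket_mull !to_CAB_ket3 braket_ket3 tensmxE mxE mulrC.
Qed.

(** * Entries of an orthogonality-preserving operator *)

Variable S : set 'cV[C]_(d1 * d2 * d3).

Lemma pair_in_sym a b : pair_in S a b -> pair_in S b a.
Proof. by move=> [[n1 n2 n3] h]; split; [split; exact: nesym | tauto]. Qed.

Lemma pair_in_neq a b : pair_in S a b -> a <> b.
Proof. by move=> [[n1 _ _] _] ab; apply: n1; rewrite ab. Qed.

Lemma pair_in_mem a b : pair_in S a b ->
  S (ket3 a + ket3 b) /\ (S (ket3 a - ket3 b) \/ S (ket3 b - ket3 a)).
Proof.
move=> [_ [h|h]]; first by split; [|left]; apply: h; [left|right].
by split; [rewrite addrC|right]; apply: h; [left|right].
Qed.

Lemma ket3_cell (a b : idx) : ket3 a (cell b) 0 = (a == b)%:R.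
Proof. by rewrite ket3E mxE eqxx andbT (inj_eq (@cell_inj _ _ _)) eq_sym. Qed.

(** Twice |a> is the sum of |a> + |b> and |a> - |b>, and [F] vanishes on both; compatibility with
    negation covers a minus state stored as |b> - |a>. Only additivity is asked of [F], so that it
    can be either argument of a bracket. *)
Lemma pair_in_ket3 a b (F : 'cV[C]_(d1 * d2 * d3) -> C) :
  pair_in S a b -> {morph F : u v / u + v} -> {morph F : u / - u} ->
  (forall phi, S phi -> phi (cell a) 0 != 0 -> F phi = 0) -> F (ket3 a) = 0.
Proof.
move=> pab FD FN F0.
have /eqP/negPf nba := nesym (pair_in_neq pab).
suff /eqP : F (ket3 a) *+ 2 = 0 by rewrite mulrn_eq0 => /eqP.
have -> : F (ket3 a) *+ 2 = F (ket3 a + ket3 b) + F (ket3 a - ket3 b).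
  by rewrite -FD addrACA subrr addr0 FD mulr2n.
have [Sp Sm] := pair_in_mem pab; rewrite F0 ?add0r //; last first.
  by rewrite mxE !ket3_cell eqxx nba addr0 oner_eq0.
case: Sm => Sm; last rewrite -opprB FN.
  by rewrite F0 // mxE ket3_cell mxE ket3_cell eqxx nba subr0 oner_eq0.
rewrite F0 ?oppr0 // mxE ket3_cell mxE ket3_cell eqxx nba.
by rewrite sub0r oppr_eq0 oner_eq0.
Qed.

(** In <+|M|-> + <-|M|+> the cross terms cancel, leaving 2 (M_aa - M_bb). *)
Lemma preserves_diag M a b : preserves_orthogonality S M -> pair_in S a b ->
  M (cell a) (cell a) = M (cell b) (cell b).
Proof.
move=> SM pab; have /eqP/negPf nba := nesym (pair_in_neq pab).
have [Sp Sm] := pair_in_mem pab.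
have two_neq0 : (1 + 1 : C) != 0 by rewrite (pnatr_eq0 C 2).
(* The goal is symmetric in [a] and [b], so the sign of the minus state can be fixed. *)
wlog Sm' : a b pab nba Sp Sm / S (ket3 a - ket3 b) => [wl|].
  case: (Sm) => h; first exact: wl.
  symmetry; apply: wl => //; first exact: pair_in_sym.
  - by rewrite eq_sym.
  - by rewrite addrC.
  - by left.
have npm : ket3 a + ket3 b <> ket3 a - ket3 b.
  move=> /addrI/matrixP/(_ (cell b) 0)/eqP.
  by rewrite ket3_cell mxE ket3_cell eqxx -addr_eq0 (negPf two_neq0).
have := SM _ _ Sp Sm' npm; have := SM _ _ Sm' Sp (nesym npm).
rewrite !(mulmxDr, mulmxN) !(braketDl, braketDr, braketNl, braketNr) !braket_ket3.
set x := M _ _; set y := M _ _; set z := M _ _; set t := M _ _ => e1 e2.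
apply/eqP; rewrite -subr_eq0; apply/eqP/(mulfI two_neq0).
rewrite mulr0 -[RHS](addr0 0) -{1}e1 -e2 mulrDl mul1r.
by rewrite !addrA; ring.
Qed.

(** Expanding first |a>, then |c>, over states of [S] leaves brackets of a state meeting [a] with a
    state meeting [c]. No state meets both, so the two are distinct and the bracket is 0. *)
Lemma preserves_offdiag M a b c d : preserves_orthogonality S M ->
  (forall phi, S phi -> phi (cell a) 0 != 0 -> phi (cell c) 0 = 0) ->
  pair_in S a b -> pair_in S c d -> M (cell a) (cell c) = 0.
Proof.
move=> SM Sac pab pcd; rewrite -braket_ket3.
apply: (pair_in_ket3 (F := fun u => braket u (M *m ket3 c)) pab).
- by move=> u v; rewrite braketDl.
- by move=> u; rewrite braketNl.
move=> phi Sphi phia.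
apply: (pair_in_ket3 (F := fun u => braket phi (M *m u)) pcd).
- by move=> u v; rewrite mulmxDr braketDr.
- by move=> u; rewrite mulmxN braketNr.
move=> psi Spsi psic; apply: SM => // phipsi.
by move: psic; rewrite -phipsi Sac ?eqxx.
Qed.

(** * Structure of an orthogonal special set *)

Hypothesis S_orthogonal : orthogonal_set S.
Hypothesis S_special : special_ghz_set S.

Lemma special_pair phi : S phi -> exists a b,
  pair_in S a b /\ (phi = ket3 a + ket3 b \/ phi = ket3 a - ket3 b).
Proof.
have [P [Pghz [PS _ _]]] := S_special.
move=> Sphi; have : cover P (@ghz_pair C d1 d2 d3) phi by rewrite PS.
move=> -[[a b] Pab phiab].
exists a, b; split=> //; split; first exact: (Pghz (a, b)).
by left; rewrite -PS => psi psiab; exists (a, b).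
Qed.

(** Otherwise |a> + |b> and |a> + |c> would be distinct states of [S] with inner product 1. *)
Lemma pair_in_uniq a b c : pair_in S a b -> pair_in S a c -> b = c.
Proof.
move=> pab pac; apply: contrapT => /eqP/negPf nbc.
have [/eqP/negPf nab /eqP/negPf nac] := (pair_in_neq pab, pair_in_neq pac).
have [[Sab _] [Sac _]] := (pair_in_mem pab, pair_in_mem pac).
have neq : ket3 a + ket3 b <> ket3 a + ket3 c.
  move=> /addrI/matrixP/(_ (cell b) 0)/eqP.
  by rewrite !ket3_cell eqxx eq_sym [c == b]eq_sym nbc eq_sym oner_eq0.
have := S_orthogonal Sab Sac neq; rewrite -[X in braket _ X]mul1mx mulmxDr.
rewrite !(braketDl, braketDr) !braket_ket3 !mxE !(inj_eq (@cell_inj _ _ _)).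
rewrite eqxx nbc nac [b == a]eq_sym nab !addr0 => /eqP.
by rewrite oner_eq0.
Qed.

(** The support of [phi] consists of the two cells of one pair. *)
Lemma special_support phi a c : S phi -> a <> c -> ~ pair_in S a c ->
  phi (cell a) 0 != 0 -> phi (cell c) 0 = 0.
Proof.
move=> /special_pair[x [y [pxy phiE]]] /eqP nac npac.
have phic w : phi (cell w) 0 != 0 -> (x == w) || (y == w).
  case: phiE => ->; [rewrite mxE !ket3_cell|rewrite mxE ket3_cell mxE ket3_cell];
    by case: (x == w); case: (y == w); rewrite //= ?subr0 ?addr0 eqxx.
move=> /phic xya; apply/eqP; apply: contraTT xya => /phic xyc.
apply/norP; split; apply/eqP => xa; case/orP: xyc => /eqP xc.
- by rewrite -xa xc eqxx in nac.
- by apply: npac; rewrite -xa -xc.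
- by apply: npac; rewrite -xa -xc; apply: pair_in_sym.
- by rewrite -xa xc eqxx in nac.
Qed.

(** One side of a bipartition: [f] and [g] are the measured and the unmeasured
    coordinates of a cell, and [h] numbers the basis of the measured space. *)
Section Side.
Variables (V : finType) (W : eqType) (m : nat).
Variables (h : V -> 'I_m) (hV : 'I_m -> V).
Hypotheses (hK : cancel h hV) (hVK : cancel hV h).
Variables (f : idx -> V) (g : idx -> W).
Variable ext : 'M[C]_m -> 'M[C]_(d1 * d2 * d3).
Hypothesis extE : forall E a b,
  ext E (cell a) (cell b) = (g a == g b)%:R * E (h (f a)) (h (f b)).
Hypothesis fg_inj : forall a b, f a = f b -> g a = g b -> a = b.

(** When [f] keeps two coordinates this is a corresponding graph; when it keeps one, it is the
    projection of such a graph. *)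
Definition side_graph : rel V := fun x y =>
  `[< exists a b, [/\ pair_in S a b, f a = x & f b = y] >].

Lemma side_graph_sym : symmetric side_graph.
Proof.
by move=> x y; apply/asboolP/asboolP => -[a [b [/pair_in_sym]]]; exists b, a.
Qed.

Lemma connected_only_trivial (w : W) :
  (forall a b, ghz_like a b -> g a <> g b) ->
  (forall x, exists a, [/\ cells S a, f a = x & g a = w]) ->
  graph_connected side_graph -> only_trivial_povm S ext.
Proof.
move=> ghz_g plane conn r E _ SE k; have {SE} SE := SE k.
(* Cells over [x] and [y] are both taken with unmeasured part [w]: the entry of [E] is then an entry
   of [ext E], and the cells cannot form a pair, since paired cells differ under [g]. *)
have offdiag x y : x != y -> E k (h x) (h y) = 0.
  move=> /eqP nxy; have [a [[b pab] fa ga]] := plane x.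
  have [c [[d pcd] fc gc]] := plane y.
  have nac : a <> c by move=> ac; apply: nxy; rewrite -fa -fc ac.
  have npac : ~ pair_in S a c by move=> [/ghz_g]; rewrite ga gc.
  rewrite -fa -fc -[LHS]mul1r -[1]/(true%:R) -(eqxx (g a)) {2}ga -gc -extE.
  apply: preserves_offdiag SE _ pab pcd => phi Sphi.
  exact: special_support Sphi nac npac.
have edge x y : side_graph x y -> E k (h x) (h x) = E k (h y) (h y).
  move=> /asboolP[a [b [pab <- <-]]].
  by have := preserves_diag SE pab; rewrite !extE !eqxx !mul1r.
have diag x y : E k (h x) (h x) = E k (h y) (h y).
  have /connectP[p] := conn x y; elim: p x => /= [x _ -> //|z p IH x].
  by move=> /andP[/edge -> /IH].
(* The scalar is any diagonal entry; in dimension 0 there is none, and 0 serves. *)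
apply/is_scalar_mxP; have [i0 _|no] := pickP 'I_m; last first.
  by exists 0; apply/matrixP => i; have := no i.
exists (E k i0 i0); apply/matrixP => i j.
rewrite -(hVK i0) -(hVK i) -(hVK j) !mxE (can_eq hK).
by case: (eqVneq (hV i) (hV j)) => [->|/offdiag ->]; rewrite // (diag _ (hV i0)).
Qed.

(** Both cells of a pair have the same eigenvalue, so every state of [S] is an eigenvector and
    orthogonality of [S] itself concludes. *)
Lemma diag_preserves (D : pred V) :
  (forall a b, pair_in S a b -> D (f a) = D (f b)) ->
  preserves_orthogonality S (ext (diag_mx (\row_i (D (hV i))%:R))).
Proof.
move=> Dpair phi psi Sphi Spsi neq.
set M := ext _.
(* A nonzero entry of [M] needs cells agreeing under [g] (identity factor) and under [f] (diagonal
   factor), hence equal cells. *)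
have Mket a : M *m ket3 a = (D (f a))%:R *: ket3 a.
  apply/colP => r; case: (mxtens_indexP r) => r12 k.
  case: (mxtens_indexP r12) => i j.
  rewrite -[mxtens_index (_, k)]/(cell (i, j, k)); move: (i, j, k) => t.
  have -> : (M *m ket3 a) (cell t) 0 = M (cell t) (cell a).
    by rewrite ket3E -colE mxE.
  rewrite [RHS]mxE ket3_cell extE !mxE hK (can_eq hK); case: (eqVneq a t) => [->|nat].
    by rewrite !eqxx mul1r mulr1n mulr1.
  case: eqP => [gat|_]; last by rewrite mul0r mulr0.
  case: eqP => [fat|_]; last by rewrite mulr0n !mulr0.
  by case/eqP: nat; apply: fg_inj.
have [a [b [pab psiE]]] := special_pair Spsi.
have -> : M *m psi = (D (f a))%:R *: psi.
  case: psiE => ->; rewrite mulmxDr ?mulmxN !Mket -(Dpair _ _ pab).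
    by rewrite scalerDr.
  by rewrite scalerBr.
by rewrite /braket -scalemxAr mxE [X in _ * X]S_orthogonal ?mulr0.
Qed.

Lemma only_trivial_connected :
  only_trivial_povm S ext -> graph_connected side_graph.
Proof.
move=> triv x y.
(* [E ord0] projects onto the component of [x], the other element onto its complement. *)
pose D (b : bool) : pred V := fun z => connect side_graph x z == b.
pose E (k : 'I_2) := diag_mx (\row_i (D (k == ord0) (hV i))%:R) : 'M[C]_m.
have Epovm : povm E.
  split=> [k|]; first by apply: psdmx_diag => i; rewrite mxE ler0n.
  rewrite !big_ord_recl big_ord0 addr0 /E -raddfD -diag_const_mx /=.
  congr diag_mx; apply/rowP => i; rewrite !mxE /D.
  by case: connect; rewrite ?addr0 ?add0r.
have Epres k : preserves_orthogonality S (ext (E k)).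
  apply: diag_preserves => a b pab; rewrite /D.
  have ab : side_graph (f a) (f b) by apply/asboolP; exists a, b.
  by rewrite (same_connect_r (sym_connect_sym side_graph_sym) (connect1 ab)).
have /is_scalar_mxP[c Ec] := triv _ _ Epovm Epres ord0.
(* Triviality makes the indicator of the component constant, and its value at [x] is 1. *)
have Ez z : (connect side_graph x z)%:R = c.
  have /matrixP/(_ (h z) (h z)) := Ec; rewrite !mxE hK /D !eqxx !mulr1n => <-.
  by case: connect.
have /eqP := Ez y; rewrite -(Ez x) connect0 eqr_nat; by case: connect.
Qed.

End Side.

(** * The corresponding graphs and the six sides *)

Lemma graph_AE : graph_A S =2 side_graph (fun a => (a.1.2, a.2)).
Proof.
move=> [j k] [j' k']; apply/asboolP/asboolP => [[i [i' p]]|].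
  by exists (i, j, k), (i', j', k').
by move=> [[[i ?] ?] [[[i' ?] ?] [/= p [<- <-] [<- <-]]]]; exists i, i'.
Qed.

Lemma graph_BE : graph_B S =2 side_graph (fun a => (a.2, a.1.1)).
Proof.
move=> [k i] [k' i']; apply/asboolP/asboolP => [[j [j' p]]|].
  by exists (i, j, k), (i', j', k').
by move=> [[[? j] ?] [[[? j'] ?] [/= p [<- <-] [<- <-]]]]; exists j, j'.
Qed.

Lemma graph_CE : graph_C S =2 side_graph (fun a => a.1).
Proof.
move=> [i j] [i' j']; apply/asboolP/asboolP => [[k [k' p]]|].
  by exists (i, j, k), (i', j', k').
by move=> [[[? ?] k] [[[? ?] k'] [/= p [<- <-] [<- <-]]]]; exists k, k'.
Qed.

(** Projection maps edges to edges, so single-party sides inherit connectedness from two-party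
    ones. *)
Lemma side_graph_comp (V V' : finType) (f : idx -> V) (p : V -> V') :
  graph_connected (side_graph f) ->
  forall x y, connect (side_graph (p \o f)) (p x) (p y).
Proof.
move=> conn x y; apply: homo_connect (conn x y) => {x y} x y.
by move=> /asboolP[a [b [pab <- <-]]]; apply/asboolP; exists a, b.
Qed.

Lemma graph_connectedE (V : finType) (e e' : rel V) :
  e =2 e' -> graph_connected e = graph_connected e'.
Proof.
move=> /eq_connect ee; apply/propext; split=> conn x y;
  by [rewrite -ee | rewrite ee].
Qed.

Lemma strongest_nonlocalP : plane_containing S ->
  strongest_nonlocal S <->
  [/\ graph_connected (graph_A S), graph_connected (graph_B S)
    & graph_connected (graph_C S)].
Proof.
move=> [i0 [j0 [k0 [plane_i plane_j plane_k]]]].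
rewrite (graph_connectedE graph_AE) (graph_connectedE graph_BE).
rewrite (graph_connectedE graph_CE).
have idK n : cancel (@id 'I_n) id by [].
have ixK m n := @mxtens_indexK m n.
have uxK m n := @mxtens_unindexK m n.
split=> [[[_ tA] [_ tB] [_ tC]]|[cA cB cC]].
  split.
  - apply: (only_trivial_connected (ixK _ _) ext_BCE _ tA).
    by move=> [[? ?] ?] [[? ?] ?] /= [-> ->] ->.
  - apply: (only_trivial_connected (ixK _ _) ext_CAE _ tB).
    by move=> [[? ?] ?] [[? ?] ?] /= [-> ->] ->.
  - apply: (only_trivial_connected (ixK _ _) ext_ABE _ tC).
    by move=> [[? ?] ?] [[? ?] ?] /= [-> ->] ->.
split; split.
(* For a single party, [w] fixes two coordinates and the cells used form a line inside a plane. Its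
   connectedness is projected from the graph whose second coordinate is that party's; the first
   coordinate is filled arbitrarily. *)
- apply: (connected_only_trivial (idK _) (idK _) ext_AE (w := (j0, k0))).
  + by move=> a b [_ n _] [].
  + by move=> i; exists (i, j0, k0).
  + by move=> x y; apply: (side_graph_comp snd cB (k0, x) (k0, y)).
- apply: (connected_only_trivial (ixK _ _) (uxK _ _) ext_BCE (w := i0)) => //.
  + by move=> a b [].
  + by move=> [j k]; exists (i0, j, k).
- apply: (connected_only_trivial (idK _) (idK _) ext_BE (w := (i0, k0))).
  + by move=> a b [n _ _] [].
  + by move=> j; exists (i0, j, k0).
  + by move=> x y; apply: (side_graph_comp snd cC (i0, x) (i0, y)).
- apply: (connected_only_trivial (ixK _ _) (uxK _ _) ext_CAE (w := j0)) => //.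
  + by move=> a b [].
  + by move=> [k i]; exists (i, j0, k).
- apply: (connected_only_trivial (idK _) (idK _) ext_CE (w := (i0, j0))).
  + by move=> a b [n _ _] ab; apply: n; rewrite ab.
  + by move=> k; exists (i0, j0, k).
  + by move=> x y; apply: (side_graph_comp snd cA (j0, x) (j0, y)).
- apply: (connected_only_trivial (ixK _ _) (uxK _ _) ext_ABE (w := k0)) => //.
  + by move=> a b [].
  + by move=> [i j]; exists (i, j, k0).
Qed.

End Tripartite.

Theorem theorem1 (R : realType) (d1 d2 d3 : nat)
    (d1_gt0 : (0 < d1)%N) (d2_gt0 : (0 < d2)%N) (d3_gt0 : (0 < d3)%N)
    (S : set 'cV[complex R]_(d1 * d2 * d3))
    (S_orthogonal : orthogonal_set S)
    (S_special : special_ghz_set S)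
    (S_plane : plane_containing S) :
  strongest_nonlocal S <->
  [/\ graph_connected (graph_A S),
      graph_connected (graph_B S)
    & graph_connected (graph_C S)].
Proof. exact: strongest_nonlocalP. Qed.
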